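(* Let $D$ be an integral domain that is not a field, with quotient field $K$. Let $\Theta$ be a family of overrings of $D$ such that: (i) $\Theta$ is locally finite; (ii) $D=\bigcap\{T\mid T\in\Theta\}$; (iii) $\mathrm{Inv}(T)$ is free for every $T\in\Theta$. Then $\mathrm{Inv}(D)$ is free.
   Context: For an integral domain $A$ with quotient field $F$, a fractional ideal is an $A$-submodule $I$ of $F$ with $dI\subseteq A$ for some nonzero $d\in F$; it is invertible if $IJ=A$ for some fractional ideal $J$. $\mathrm{Inv}(A)$ denotes the group of invertible fractional ideals of $A$ under multiplication. ''Free'' always means free abelian. An overring of $D$ is a ring $T$ with $D\subseteq T\subseteq K$. A family $\Theta$ of overrings of $D$ is locally finite if for every nonzero $x\in D$ we have $xT=T$ for all but finitely many $T\in\Theta$. *)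

(* Defs.v *)
From HB Require Import structures.
From mathcomp Require Import all_boot all_order all_algebra fraction.
From mathcomp Require Import boolp classical_sets functions cardinality.
From mathcomp Require Import freeg.

Set Implicit Arguments.
Unset Strict Implicit.
Unset Printing Implicit Defensive.

Import GRing.Theory.
Local Open Scope classical_set_scope.
Local Open Scope ring_scope.

(* Subrings are predicates together with a closure proof, so Leibniz equality
   of subrings (used when counting members of a family) is equality of the
   underlying sets. *)
Lemma subringClosed_ext (R : pzRingType) (A B : subringClosed R) :
  A =i B -> A = B.
Proof.
case: A B => [A [[zA] [oA] [mA] [nA]]] [B [[zB] [oB] [mB] [nB]]] eqAB.
have {}eqAB : A = B by apply/funext => x; exact: eqAB.
move: zA oA mA nA; rewrite eqAB => zA oA mA nA.
by rewrite (Prop_irrelevance zA zB) (Prop_irrelevance oA oB)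
  (Prop_irrelevance mA mB) (Prop_irrelevance nA nB).
Qed.

Section FractionalIdeals.
Variables (F : fieldType) (A : subringClosed F).
Implicit Types (I J M : set F) (x y z : F).

Definition submodule_of I : Prop :=
  [/\ I 0, forall x y, I x -> I y -> I (x + y)
    & forall a x, a \in A -> I x -> I (a * x)].

Definition fractional_ideal I : Prop :=
  submodule_of I /\ exists2 d, d != 0 & forall x, I x -> d * x \in A.

Definition ideal_mul I J : set F :=
  [set x | exists2 s : seq (F * F), (forall p, p \in s -> I p.1 /\ J p.2)
         & x = \sum_(p <- s) p.1 * p.2].

Definition invertible_ideal I : Prop :=
  fractional_ideal I /\
  exists2 J, fractional_ideal J & ideal_mul I J = [set` A].

Definition ideal_inv I : set F := [set x | forall y, I y -> x * y \in A].

Lemma mem_ideal_mul I J x y : I x -> J y -> ideal_mul I J (x * y).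
Proof.
move=> Ix Jy; exists [:: (x, y)]; last by rewrite big_seq1.
by move=> p; rewrite inE => /eqP ->.
Qed.

Lemma ideal_mul_sub I J M :
    M 0 -> (forall x y, M x -> M y -> M (x + y)) ->
    (forall x y, I x -> J y -> M (x * y)) ->
  ideal_mul I J `<=` M.
Proof.
move=> M0 MD MIJ _ [s sIJ ->]; rewrite big_seq.
by apply: big_ind => // p /sIJ [Ip Jp]; exact: MIJ.
Qed.

Lemma ideal_mul0 I J : ideal_mul I J 0.
Proof. by exists [::] => //; rewrite big_nil. Qed.

Lemma ideal_mulD I J x y :
  ideal_mul I J x -> ideal_mul I J y -> ideal_mul I J (x + y).
Proof.
move=> [s hs ->] [t ht ->]; exists (s ++ t); last by rewrite big_cat.
by move=> p; rewrite mem_cat => /orP[/hs|/ht].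
Qed.

Lemma ideal_mulC I J : ideal_mul I J = ideal_mul J I.
Proof.
by apply/seteqP; split; apply: ideal_mul_sub;
  do ?[exact: ideal_mul0 | exact: ideal_mulD];
  move=> x y hx hy; rewrite mulrC; exact: mem_ideal_mul.
Qed.

Lemma ideal_mulA_sub I J M :
  ideal_mul I (ideal_mul J M) `<=` ideal_mul (ideal_mul I J) M.
Proof.
apply: ideal_mul_sub; [exact: ideal_mul0 | exact: ideal_mulD |].
move=> x y Ix; apply: (@ideal_mul_sub J M
  [set z | ideal_mul (ideal_mul I J) M (x * z)]) => /=.
- by rewrite mulr0; exact: ideal_mul0.
- by move=> u v; rewrite mulrDr; exact: ideal_mulD.
- by move=> u v Ju Mv; rewrite mulrA; do 2?apply: mem_ideal_mul.
Qed.

Lemma ideal_mulA I J M :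
  ideal_mul I (ideal_mul J M) = ideal_mul (ideal_mul I J) M.
Proof.
apply/seteqP; split; first exact: ideal_mulA_sub.
rewrite (ideal_mulC (ideal_mul I J)) (ideal_mulC I J).
rewrite (ideal_mulC I) (ideal_mulC J M).
exact: ideal_mulA_sub.
Qed.

Lemma ideal_mul1 I : submodule_of I -> ideal_mul [set` A] I = I.
Proof.
move=> [I0 ID IZ]; apply/seteqP; split; first exact: ideal_mul_sub.
by move=> x Ix; rewrite -[x]mul1r; apply: mem_ideal_mul; rewrite //= rpred1.
Qed.

Lemma fractional_ideal_mul I J :
  fractional_ideal I -> fractional_ideal J -> fractional_ideal (ideal_mul I J).
Proof.
move=> [[I0 ID IZ] [d d0 dI]] [[J0 JD JZ] [e e0 eJ]]; split.
  split; [exact: ideal_mul0 | exact: ideal_mulD |].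
  move=> a x aA; apply: (@ideal_mul_sub I J
    [set z | ideal_mul I J (a * z)]) => /=.
  - by rewrite mulr0; exact: ideal_mul0.
  - by move=> u v; rewrite mulrDr; exact: ideal_mulD.
  - by move=> u v Iu Jv; rewrite mulrA; apply: mem_ideal_mul => //; exact: IZ.
exists (d * e); first by rewrite mulf_neq0.
apply: (@ideal_mul_sub I J [set z | d * e * z \in A]) => /=.
- by rewrite mulr0 rpred0.
- by move=> u v; rewrite mulrDr; exact: rpredD.
- by move=> u v /dI Iu /eJ Jv; rewrite mulrACA rpredM.
Qed.

Lemma fractional_ideal1 : fractional_ideal [set` A].
Proof.
split; first by split=> /= [|x y|a x]; [exact: rpred0|exact: rpredD|exact: rpredM].
by exists 1 => [|x /=]; rewrite ?oner_neq0 ?mul1r.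
Qed.

Lemma invertible_ideal1 : invertible_ideal [set` A].
Proof.
split; first exact: fractional_ideal1.
exists [set` A]; first exact: fractional_ideal1.
by apply: ideal_mul1; case: fractional_ideal1.
Qed.

Lemma invertible_ideal_mul I J :
  invertible_ideal I -> invertible_ideal J -> invertible_ideal (ideal_mul I J).
Proof.
move=> [fI [I' fI' II']] [fJ [J' fJ' JJ']].
split; first exact: fractional_ideal_mul.
exists (ideal_mul J' I'); first exact: fractional_ideal_mul.
rewrite ideal_mulA -(ideal_mulA I) JJ' (ideal_mulC I) ideal_mul1 //.
by case: fI.
Qed.

Lemma fractional_ideal_inv I :
  invertible_ideal I -> fractional_ideal (ideal_inv I).
Proof.
move=> [fI [J fJ IJ]]; split.
  split=> [y Iy|x y hx hy z Iz|a x aA hx z Iz].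
  - by rewrite mul0r rpred0.
  - by rewrite mulrDl rpredD ?hx ?hy.
  - by rewrite -mulrA rpredM ?hx.
have [d Id d0] : exists2 d, I d & d != 0.
  apply: contrapT => h; have : ideal_mul I J 1 by rewrite IJ /= rpred1.
  suff /[apply] /eqP : ideal_mul I J `<=` [set 0] by rewrite oner_eq0.
  apply: ideal_mul_sub => //= [x y -> ->|x y Ix _]; first by rewrite addr0.
  have [->|x0] := eqVneq x 0; first by rewrite mul0r.
  by case: h; exists x.
by exists d => // x hx; rewrite mulrC; exact: hx.
Qed.

Lemma ideal_mulVI I : invertible_ideal I -> ideal_mul (ideal_inv I) I = [set` A].
Proof.
move=> [fI [J fJ IJ]]; apply/seteqP; split.
  apply: ideal_mul_sub => /= [|x y|x y]; [exact: rpred0 | exact: rpredD |].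
  by move=> hx Iy; exact: hx.
rewrite -IJ ideal_mulC; apply: ideal_mul_sub.
- exact: ideal_mul0.
- exact: ideal_mulD.
move=> x y Jx Iy; apply: mem_ideal_mul => // z Iz.
have : ideal_mul I J (z * x) by exact: mem_ideal_mul.
by rewrite IJ /= mulrC.
Qed.

Lemma invertible_ideal_inv I : invertible_ideal I -> invertible_ideal (ideal_inv I).
Proof.
move=> iI; split; first exact: fractional_ideal_inv.
by exists I; [case: iI | exact: ideal_mulVI].
Qed.

End FractionalIdeals.

(* Meaningful when F is the quotient field of A, which is automatic for every
   overring of a domain with quotient field F. *)
Record InvIdeal (F : fieldType) (A : subringClosed F) := MkInvIdeal {
  inv_ideal :> set F;
  inv_idealP : invertible_ideal A inv_ideal
}.

Section InvGroup.
Variables (F : fieldType) (A : subringClosed F).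

Lemma Inv_ext (I J : InvIdeal A) : inv_ideal I = inv_ideal J -> I = J.
Proof.
case: I J => [I hI] [J hJ] /= eqIJ; move: hI; rewrite eqIJ => hI.
by rewrite (Prop_irrelevance hI hJ).
Qed.

Definition Inv_one : InvIdeal A := MkInvIdeal (invertible_ideal1 A).
Definition Inv_mul (I J : InvIdeal A) : InvIdeal A :=
  MkInvIdeal (invertible_ideal_mul (inv_idealP I) (inv_idealP J)).
Definition Inv_inv (I : InvIdeal A) : InvIdeal A :=
  MkInvIdeal (invertible_ideal_inv (inv_idealP I)).

Lemma Inv_mulA : associative Inv_mul.
Proof. by move=> I J M; apply: Inv_ext; exact: ideal_mulA. Qed.

Lemma Inv_mul1 : left_id Inv_one Inv_mul.
Proof.
by move=> I; apply: Inv_ext; apply: ideal_mul1; case: (inv_idealP I) => -[].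
Qed.

Lemma Inv_mulC : commutative Inv_mul.
Proof. by move=> I J; apply: Inv_ext; exact: ideal_mulC. Qed.

Lemma Inv_mulV : left_inverse Inv_one Inv_inv Inv_mul.
Proof. by move=> I; apply: Inv_ext; exact/ideal_mulVI/inv_idealP. Qed.

Lemma Inv_mul1r : right_id Inv_one Inv_mul.
Proof. by move=> I; rewrite Inv_mulC Inv_mul1. Qed.

Lemma Inv_mulVr : right_inverse Inv_one Inv_inv Inv_mul.
Proof. by move=> I; rewrite Inv_mulC Inv_mulV. Qed.

HB.instance Definition _ := gen_eqMixin (InvIdeal A).
HB.instance Definition _ := gen_choiceMixin (InvIdeal A).
HB.instance Definition _ := isGroup.Build (InvIdeal A)
  Inv_mulA Inv_mul1 Inv_mul1r Inv_mulV Inv_mulVr.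

End InvGroup.

Definition free_abelian (G : groupType) : Prop :=
  exists (B : choiceType) (f : G -> {freeg B}),
    bijective f /\ {morph f : x y / (x * y)%g >-> x + y}.

Section Overrings.
Variable D : idomainType.
Local Notation K := {fraction D}.

Definition domain_pred : {pred K} := fun x => `[< range (@tofrac D) x >].

Lemma domain_pred_subring : subring_closed domain_pred.
Proof.
split=> [|_ _ /asboolP[a _ <-] /asboolP[b _ <-]|_ _ /asboolP[a _ <-] /asboolP[b _ <-]];
  apply/asboolP.
- by exists 1 => //; rewrite tofrac1.
- by exists (a - b) => //; rewrite tofracB.
- by exists (a * b) => //; rewrite tofracM.
Qed.

HB.instance Definition _ := GRing.isSubringClosed.Build K domain_pred
  domain_pred_subring.

(* D identified with its image in its quotient field *)
Definition domain_subring : subringClosed K := domain_pred.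

Definition overring (T : subringClosed K) : Prop := {subset domain_subring <= T}.

Definition locally_finite (Theta : set (subringClosed K)) : Prop :=
  forall x : D, x != 0 ->
    finite_set [set T | Theta T /\ [set tofrac x * t | t in [set` T]] <> [set` T]].

End Overrings.

(* Main.v *)
Require Import Defs.
From HB Require Import structures.
From mathcomp Require Import all_boot all_order all_algebra fraction.
From mathcomp Require Import boolp classical_sets functions cardinality.
From mathcomp Require Import wochoice freeg.

(* The extensions I |-> IT embed Inv(D) into the direct sum of the groups Inv(T).
   An invertible ideal I satisfies IT = T for almost all T, as it is squeezed
   between nonzero principal fractional ideals; and if IT = T for all T then I
   and its inverse both lie in the intersection D of the T, so that I = D.  It
   remains to see that a subgroup of a free abelian group is free: well-order
   the basis, and for every b occurring as a leading position in the subgroup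
   choose an element with leading position b whose leading coefficient has
   minimal absolute value; the chosen elements form a basis of the subgroup. *)

Set Implicit Arguments.
Unset Strict Implicit.
Unset Printing Implicit Defensive.

Import GRing.Theory Num.Theory.
Local Open Scope classical_set_scope.
Local Open Scope ring_scope.

(** * Subgroups of a free abelian group, given by finitely supported integer coordinates *)

Lemma seq_max_ex (T : eqType) (R : rel T) (s : seq T) :
    total R -> transitive R -> s != [::] ->
  exists2 m, m \in s & {in s, forall x, R x m}.
Proof.
move=> Rtot Rtr; elim: s => [//|a [|b s] IHs] _.
  exists a; first exact: mem_head.
  by move=> x; rewrite inE => /eqP ->; rewrite -[R a a]orbb Rtot.
have [//|m ms mP] := IHs.
have [Ram|Rma] := orP (Rtot a m).
  exists m; first by rewrite inE ms orbT.
  by move=> x; rewrite inE => /predU1P[->//|]; exact: mP.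
exists a; first exact: mem_head.
move=> x; rewrite inE => /predU1P[->|/mP Rxm]; last exact: Rtr Rxm Rma.
by rewrite -[R a a]orbb Rtot.
Qed.

Lemma fglift_sumE (K : choiceType) (v : K -> int) (x : {freeg K}) :
  fglift (v : K -> int^o) x = \sum_(k <- dom x) coeff k x * v k.
Proof. by rewrite -{1}[x]Freeg_dom fglift_Freeg /prelift big_map. Qed.

Section FreeSubgroup.
Variables (G : groupType) (B : choiceType) (phi : G -> B -> int).
Hypothesis phiM : forall g h b, phi (g * h)%g b = phi g b + phi h b.
Hypothesis phi_inj : forall g h, phi g =1 phi h -> g = h.
Hypothesis phi_fin : forall g, finite_set [set b | phi g b != 0].

Lemma phi1 b : phi 1%g b = 0.
Proof. by apply: (addrI (phi 1%g b)); rewrite -phiM mulg1 addr0. Qed.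

Lemma phiV g b : phi g^-1%g b = - phi g b.
Proof. by apply/eqP; rewrite -addr_eq0 -phiM mulVg phi1. Qed.

Lemma phiX g n b : phi (g ^+ n)%g b = n%:Z * phi g b.
Proof.
elim: n => [|n IHn]; first by rewrite expg0 phi1 mul0r.
by rewrite expgS phiM IHn -addn1 PoszD mulrDl mul1r addrC.
Qed.

Lemma phi_comb g h (q : int) : exists u, forall b, phi u b = phi g b + q * phi h b.
Proof.
case: q => n.
  by exists (g * h ^+ n)%g => b; rewrite phiM phiX.
by exists (g * (h ^+ n.+1)^-1)%g => b; rewrite phiM phiV phiX NegzE mulNr.
Qed.

Lemma phi_sum (K : Type) (e : K -> G) (a : K -> int) (s : seq K) :
  exists u, forall b, phi u b = \sum_(k <- s) a k * phi (e k) b.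
Proof.
elim: s => [|k s [u uP]]; first by exists 1%g => b; rewrite big_nil phi1.
have [w wP] := phi_comb u (e k) (a k).
by exists w => b; rewrite big_cons wP uP addrC.
Qed.

Let R : rel B := sval (well_ordering_principle B).
Let R_wo : well_order R := svalP (well_ordering_principle B).

Let R_min (P : B -> Prop) b : P b -> exists2 m, P m & forall c, P c -> R m c.
Proof.
move=> Pb; have [|m [[mP mmin] _]] := R_wo (A := fun b => `[< P b >]).
  by exists b; apply/asboolP.
by exists m => [|c Pc]; [exact/asboolP | exact/mmin/asboolP].
Qed.

(** The order axioms are read off from minima of sets with two or three elements; antisymmetry comes
    from the uniqueness of the minimum. *)
Let R_tot : total R.
Proof.
move=> x y; have [|m] := @R_min [set z | z \in [:: x; y]] x; first exact: mem_head.
rewrite /= !inE => /orP[]/eqP-> mmin; apply/orP; [left|right]; apply: mmin;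
by rewrite /= !inE eqxx ?orbT.
Qed.

Let R_anti : antisymmetric R.
Proof.
move=> x y /andP[Rxy Ryx].
have [|m [_ muniq]] := R_wo (A := [pred z | z \in [:: x; y]]).
  by exists x; exact: mem_head.
have Rzz z : R z z by rewrite -[R z z]orbb R_tot.
by rewrite -(muniq x) ?(muniq y) //; split=> [|z]; rewrite !inE ?eqxx ?orbT //;
  case/orP=> /eqP ->.
Qed.

Let R_trans : transitive R.
Proof.
move=> y x z Rxy Ryz.
have [m Pm mmin] := @R_min [set t | t \in [:: x; y; z]] x (mem_head _ _).
have [mx my mz] : [/\ R m x, R m y & R m z].
  by split; apply: mmin; rewrite /= !inE eqxx ?orbT.
move: Pm; rewrite /= !inE => /or3P[] /eqP em; rewrite em in mx my mz => //.
  by rewrite (R_anti (x := x) (y := y)) // Rxy.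
by rewrite (R_anti (x := z) (y := y)) // my Ryz.
Qed.

Definition leading g b := phi g b != 0 /\ forall c, phi g c != 0 -> R c b.

Lemma leading_ex g : (forall b, phi g b = 0) \/ exists b, leading g b.
Proof.
have /finite_seqP[s sP] := phi_fin g.
have sE b : (phi g b != 0) = (b \in s).
  by apply/idP/idP; rewrite -[is_true (b \in s)]/([set` s] b) -sP.
have [s0|s0] := eqVneq s [::].
  by left=> b; apply/eqP/negbNE; rewrite sE s0.
have [m ms mP] := seq_max_ex R_tot R_trans s0.
by right; exists m; split=> [|c]; rewrite sE //; exact: mP.
Qed.

(** These positions index the basis to be built; the boolean reflection makes them a subtype of [B],
    so that [{freeg pivot}] is available. *)
Definition pivot : choiceType := {b : B | `[< exists g, leading g b >]}.

(** Euclidean division: if the smallest leading coefficient at this position did not divide another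
    one, subtracting a multiple would leave the nonzero remainder as a smaller leading coefficient
    there. *)
Lemma pivot_gen_ex (k : pivot) : exists2 e, leading e (val k) &
  forall g, leading g (val k) -> (phi e (val k) %| phi g (val k))%Z.
Proof.
case: k => b /= /[dup] /asboolP [g0 g0b] _.
pose P n := `[< exists2 g, leading g b & `|phi g b|%N = n >].
have exP : exists n, P n by exists `|phi g0 b|%N; apply/asboolP; exists g0.
have [n /asboolP[e eb en] nmin] := ex_minnP exP.
exists e => // g gb.
have [/dvdz_mod0P//|r0] := eqVneq (phi g b %% phi e b)%Z 0; exfalso.
have [u uP] := phi_comb g e (- (phi g b %/ phi e b)%Z).
have ub : phi u b = (phi g b %% phi e b)%Z by rewrite uP mulNr.
have /nmin : P `|phi u b|%N.
  apply/asboolP; exists u => //; split; first by rewrite ub.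
  (* The support of [u] lies in the union of those of [g] and [e], so no position above [b]
     appears. *)
  move=> c; rewrite uP; have [->|gc _] := eqVneq (phi g c) 0; last exact: gb.2.
  by rewrite add0r mulf_eq0 negb_or => /andP[_]; exact: eb.2.
by apply/negP; rewrite -ltnNge -en ub -ltz_nat gez0_abs ?modz_ge0 ?ltz_mod ?eb.1.
Qed.

Let e (k : pivot) : G := s2val (cid2 (pivot_gen_ex k)).
Let e_leading k : leading (e k) (val k) := s2valP (cid2 (pivot_gen_ex k)).
Let e_dvd k g : leading g (val k) -> (phi (e k) (val k) %| phi g (val k))%Z :=
  s2valP' (cid2 (pivot_gen_ex k)) g.

(** Formal combinations of the generators [e k] are evaluated one coordinate at a time, in the
    module [int^o], because [G] itself is only a multiplicative group. *)
Definition pivot_comb (b : B) : {freeg pivot} -> int :=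
  fglift (fun k => phi (e k) b : int^o).

Lemma pivot_comb_is_zmod_morphism b : zmod_morphism (pivot_comb b).
Proof. exact: (@lift_is_additive int pivot int^o). Qed.

HB.instance Definition _ b := GRing.isZmodMorphism.Build {freeg pivot} int
  (pivot_comb b) (pivot_comb_is_zmod_morphism b).

Lemma pivot_combU c k b : pivot_comb b << c *g k >> = c * phi (e k) b.
Proof. by rewrite /pivot_comb liftU. Qed.

(** Independence of the generators: at the largest pivot [k] in the support of [x], every other
    generator involved leads strictly below and vanishes, so the term of [e k] alone would be
    nonzero. *)
Lemma pivot_comb0 x : (forall b, pivot_comb b x = 0) -> x = 0.
Proof.
move=> x0; apply/eqP; rewrite -dom_eq0; apply: contrapT => /negP dx.
have [|_ /mapP[k kx ->] kmax] :=
    seq_max_ex R_tot R_trans (s := [seq val k | k <- dom x]).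
  by case: (dom x) dx.
have := x0 (val k); rewrite /pivot_comb fglift_sumE (bigD1_seq k) ?uniq_dom //=.
rewrite big1_seq ?addr0 => [/eqP|l /andP[lk lx]].
  by rewrite mulf_eq0 -[_ == 0]negbK -mem_dom kx (negPf (e_leading k).1).
apply/eqP; rewrite mulf_eq0; apply/orP; right; apply: contrapT => /negP.
move/(e_leading l).2 => Rkl; case/eqP: lk; apply/val_inj/R_anti.
by rewrite Rkl kmax // map_f.
Qed.

Lemma pivot_comb_inj x y : pivot_comb^~ x =1 pivot_comb^~ y -> x = y.
Proof.
move=> xy; apply/eqP; rewrite -subr_eq0; apply/eqP/pivot_comb0 => b.
by rewrite raddfB /= xy subrr.
Qed.

Lemma pivot_comb_image x : exists u, phi u =1 pivot_comb^~ x.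
Proof.
have [u uP] := phi_sum e (fun k => coeff k x) (dom x).
by exists u => b; rewrite uP /pivot_comb fglift_sumE.
Qed.

(** Well-founded induction on the leading position: a suitable multiple of the generator there
    cancels the leading coefficient, and what remains leads at a smaller position. *)
Lemma pivot_comb_span g : exists x, pivot_comb^~ x =1 phi g.
Proof.
have [g0|[b gb]] := leading_ex g; first by exists 0 => b; rewrite raddf0 g0.
move: g gb; apply: contrapT => bad.
pose P c := forall g, leading g c -> exists x, pivot_comb^~ x =1 phi g.
(* [m] is the least leading position of an element outside the span. *)
have [m mbad mmin] := @R_min (fun c => ~ P c) _ bad.
apply: mbad => g gm.
have mpiv : `[< exists g, leading g m >] by apply/asboolP; exists g.
pose k : pivot := exist _ m mpiv; have /dvdzP[q gq] := e_dvd (k := k) gm.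
have [u uP] := phi_comb g (e k) (- q).
have um : phi u m = 0 by rewrite uP gq mulNr subrr.
have Ru c : phi u c != 0 -> R c m.
  rewrite uP; have [->|gc _] := eqVneq (phi g c) 0; last exact: gm.2.
  by rewrite add0r mulf_eq0 negb_or => /andP[_]; exact: (e_leading k).2.
suff [x xP] : exists x, pivot_comb^~ x =1 phi u.
  exists (x + << q *g k >>) => c.
  by rewrite raddfD /= pivot_combU xP uP mulNr subrK.
have [u0|[c uc]] := leading_ex u; first by exists 0 => b'; rewrite raddf0 u0.
(* If [u] failed, minimality would put its leading position [c] at or above [m], and [Ru] at or
   below; but [u] vanishes at [m]. *)
apply: contrapT => ubad; have /mmin Rmc : ~ P c by move/(_ u uc).
have cm : c = m by apply: R_anti; rewrite Rmc Ru ?uc.1.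
by move: uc.1; rewrite cm um eqxx.
Qed.

Lemma free_abelian_finsupp : free_abelian G.
Proof.
(* The isomorphism sends [g] to its coefficients in the pivot generators, unique by independence. *)
exists pivot, (fun g => projT1 (cid (pivot_comb_span g))); split.
  exists (fun x => projT1 (cid (pivot_comb_image x))) => [g|x].
    case: (cid (pivot_comb_span g)) => x /= xP.
    by case: cid => h /= hP; apply: phi_inj => b; rewrite hP xP.
  case: (cid (pivot_comb_image x)) => h /= hP.
  by case: cid => y /= yP; apply: pivot_comb_inj => b; rewrite yP hP.
move=> g h; case: cid => x /= xP; case: cid => y /= yP; case: cid => z /= zP.
by apply: pivot_comb_inj => b; rewrite raddfD /= xP yP zP phiM.
Qed.

End FreeSubgroup.

(** The group embeds in the direct sum of the [H i], which is free on the disjoint union of their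
    bases; only the coordinates over this union are needed, not the direct sum itself. *)
Lemma free_abelian_family (G : groupType) (I : Type) (H : I -> groupType)
    (phi : forall i, G -> H i) :
    (forall i, {morph phi i : x y / (x * y)%g}) ->
    (forall g, (forall i, phi i g = 1%g) -> g = 1%g) ->
    (forall g, finite_set [set i | phi i g <> 1%g]) ->
    (forall i, free_abelian (H i)) ->
  free_abelian G.
Proof.
move=> phiM phi_ker phi_fin Hfree.
pose B i := projT1 (cid (Hfree i)).
pose f i : H i -> {freeg (B i)} := projT1 (cid (projT2 (cid (Hfree i)))).
have [f_bij fM] : (forall i, bijective (f i)) /\
    (forall i, {morph f i : x y / (x * y)%g >-> x + y}).
  by split=> i; case: (projT2 (cid (projT2 (cid (Hfree i))))).
have phi1 i : phi i 1%g = 1%g by apply: (mulgI (phi i 1%g)); rewrite -phiM !mulg1.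
have f1 i : f i 1%g = 0 by apply: (addrI (f i 1%g)); rewrite -fM mulg1 addr0.
(* [classic] equips the disjoint union of the bases with a choice structure, since the index type
   [I] has none. *)
apply: (@free_abelian_finsupp G {classic {i & B i}}
  (fun g b => coeff (projT2 b) (f (projT1 b) (phi (projT1 b) g)))).
- by move=> g h b; rewrite phiM fM coeffD.
- move=> g h gh; apply: (mulIg h^-1%g); rewrite mulgV; apply: phi_ker => i.
  suff gh_i : phi i g = phi i h by rewrite phiM gh_i -phiM mulgV.
  apply: (bij_inj (f_bij i)); apply/eqP/freeg_eqP => b.
  exact: (gh (existT _ i b)).
- move=> g; apply: (@sub_finite_set _ _ (\bigcup_(i in [set i | phi i g <> 1%g])
    (existT B i @` [set` dom (f i (phi i g))]))).
    move=> [i b] /= cb; exists i => /=.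
      by move=> gi; move: cb; rewrite gi f1 coeff0 eqxx.
    by exists b => //=; rewrite mem_dom.
  apply: bigcup_finite => // i _; apply: finite_image; exact: finite_seq.
Qed.

(** * Extension of invertible ideals to a larger ring *)

Section Extension.
Variables (F : fieldType) (A T : subringClosed F).
Hypothesis AT : {subset A <= T}.
Implicit Types I J : set F.

Lemma ideal_mul_ext I J :
  ideal_mul (ideal_mul I [set` T]) (ideal_mul J [set` T]) =
  ideal_mul (ideal_mul I J) [set` T].
Proof.
rewrite -ideal_mulA (ideal_mulC [set` T]) -(ideal_mulA J) ideal_mulA.
by congr ideal_mul; apply: ideal_mul1; case: (fractional_ideal1 T).
Qed.

Lemma ideal_ext1 : ideal_mul [set` A] [set` T] = [set` T].
Proof.
apply: ideal_mul1; have [[T0 TD TM] _] := fractional_ideal1 T.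
by split=> // a x /AT; exact: TM.
Qed.

Lemma fractional_ideal_ext I :
  fractional_ideal A I -> fractional_ideal T (ideal_mul I [set` T]).
Proof.
move=> [_ [d d0 dI]]; split.
  split; [exact: ideal_mul0 | exact: ideal_mulD |].
  move=> a x aT; apply: (@ideal_mul_sub _ I [set` T]
    [set z | ideal_mul I [set` T] (a * z)]) => /=.
  - by rewrite mulr0; exact: ideal_mul0.
  - by move=> u v; rewrite mulrDr; exact: ideal_mulD.
  - by move=> u v Iu Tv; rewrite mulrCA; apply: mem_ideal_mul => //=; rewrite rpredM.
exists d => //; apply: (@ideal_mul_sub _ I [set` T] [set z | d * z \in T]) => /=.
- by rewrite mulr0 rpred0.
- by move=> u v; rewrite mulrDr; exact: rpredD.
- by move=> u v /dI/AT Tu Tv; rewrite mulrA rpredM.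
Qed.

Lemma invertible_ideal_ext I :
  invertible_ideal A I -> invertible_ideal T (ideal_mul I [set` T]).
Proof.
move=> [fI [J fJ IJ]]; split; first exact: fractional_ideal_ext.
exists (ideal_mul J [set` T]); first exact: fractional_ideal_ext.
by rewrite ideal_mul_ext IJ ideal_ext1.
Qed.

Definition Inv_ext_map (I : InvIdeal A) : InvIdeal T :=
  MkInvIdeal (invertible_ideal_ext (inv_idealP I)).

Lemma Inv_ext_mapM : {morph Inv_ext_map : I J / (I * J)%g}.
Proof. by move=> I J; apply: Inv_ext; rewrite /= ideal_mul_ext. Qed.

Lemma Inv_ext_map1_sub (I : InvIdeal A) :
  Inv_ext_map I = 1%g -> inv_ideal I `<=` [set` T].
Proof.
move=> /(congr1 (@inv_ideal F T)) /= IT x Ix; rewrite -[[set` T]]IT.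
by rewrite -[x]mulr1; apply: mem_ideal_mul; rewrite //= rpred1.
Qed.

End Extension.

(** * Trivial ideals and the finiteness of the set of nontrivial extensions *)

Lemma invertible_ideal_neq0 (F : fieldType) (A : subringClosed F) (I : set F) :
  invertible_ideal A I -> exists2 x, I x & x != 0.
Proof.
move=> iI; apply: contrapT => h.
have : ideal_mul (ideal_inv A I) I 1 by rewrite ideal_mulVI //= rpred1.
suff /[apply] /eqP : ideal_mul (ideal_inv A I) I `<=` [set 0] by rewrite oner_eq0.
apply: ideal_mul_sub => //= [x y -> ->|x y _ Iy]; first by rewrite addr0.
by have [->|y0] := eqVneq y 0; [rewrite mulr0 | case: h; exists y].
Qed.

Lemma fraction_denom (D : idomainType) (x : {fraction D}) :
  exists2 d : D, d != 0 & exists c, tofrac d * x = tofrac c.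
Proof.
elim/quotW: x => r; exists (frac r).2; first exact: denom_ratioP.
exists (frac r).1; unlock tofrac.
rewrite -[LHS]FracField.pi_mul; apply/eqmodP.
rewrite /= /FracField.equivf /FracField.mulf.
by rewrite !numden_Ratio ?mul1r ?mulr1 ?oner_neq0 ?denom_ratioP // mulrC.
Qed.

(** For the reverse inclusion, [A = I^-1 I] is contained in [A I], hence in [I]. *)
Lemma inv_ideal_eq1 (F : fieldType) (A : subringClosed F) (I : InvIdeal A) :
  inv_ideal I `<=` [set` A] -> inv_ideal (I^-1)%g `<=` [set` A] -> I = 1%g.
Proof.
move=> IA VA; apply: Inv_ext; apply/seteqP; split=> //=.
have [[sI _] _] := inv_idealP I; have [I0 ID IZ] := sI.
rewrite -(ideal_mulVI (inv_idealP I)).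
by apply: ideal_mul_sub => // a y /VA; exact: IZ.
Qed.

(* If [d I] is contained in [D] and [c] is a nonzero element of [I] lying in [D],
   then [I T] is squeezed between [c T] and [d^-1 T], and both are [T] for all
   but finitely many [T]. *)
Lemma ext_eq_squeeze (D : idomainType) (T : subringClosed {fraction D})
    (I : set {fraction D}) (c d : D) :
    overring T -> I (tofrac c) ->
    (forall x, I x -> tofrac d * x \in domain_subring D) ->
    d != 0 ->
    [set tofrac c * t | t in [set` T]] = [set` T] ->
    [set tofrac d * t | t in [set` T]] = [set` T] ->
  ideal_mul I [set` T] = [set` T].
Proof.
move=> DT Ic dI d0 cT dT; apply/seteqP; split.
  apply: ideal_mul_sub => /= [|x y|x y Ix Ty]; [exact: rpred0|exact: rpredD|].
  apply: rpredM => //; have /DT dxT := dI x Ix.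
  have [t Tt] : [set tofrac d * t | t in [set` T]] (tofrac d * x).
    by rewrite dT.
  by move/mulfI => <- //; rewrite tofrac_eq0.
move=> x; rewrite -{1}cT => -[t Tt <-]; exact: mem_ideal_mul.
Qed.

Lemma ext_finite (D : idomainType) (Theta : set (subringClosed {fraction D}))
    (I : InvIdeal (domain_subring D)) :
    (forall T, Theta T -> overring T) -> locally_finite Theta ->
  finite_set [set T | Theta T /\ ideal_mul (inv_ideal I) [set` T] <> [set` T]].
Proof.
move=> Theta_over Theta_fin; have iI := inv_idealP I.
have [[[I0 ID IZ] [q q0 qI]] _] := iI.
have domP a : tofrac a \in domain_subring D by apply/asboolP; exists a.
have [x Ix x0] := invertible_ideal_neq0 iI.
(* Clearing denominators turns [x] into [c = a x], still in [I], and [q] into [d = b q], which still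
   multiplies [I] into [D]. *)
have [a a0 [c xc]] := fraction_denom x.
have [b b0 [d qd]] := fraction_denom q.
have c0 : c != 0 by rewrite -tofrac_eq0 -xc mulf_neq0 ?tofrac_eq0.
have d0 : d != 0 by rewrite -tofrac_eq0 -qd mulf_neq0 ?tofrac_eq0.
apply: (@sub_finite_set _ _ (
  [set T | Theta T /\ [set tofrac c * t | t in [set` T]] <> [set` T]] `|`
  [set T | Theta T /\ [set tofrac d * t | t in [set` T]] <> [set` T]])); last first.
  by rewrite finite_setU; split; exact: Theta_fin.
move=> T [TT IT]; apply: contrapT => /not_orP[/not_andP[//|/contrapT cT]].
move=> /not_andP[//|/contrapT dT]; apply: IT.
apply: (ext_eq_squeeze (c := c) (d := d)) => //.
- exact: Theta_over.
- by rewrite -xc; apply: IZ.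
- by move=> y Iy; rewrite -qd -mulrA rpredM // qI.
Qed.

Theorem proposition3p6 (D : idomainType)
    (Theta : set (subringClosed {fraction D}))
    (D_not_field : ~ (forall x : D, x != 0 -> x \is a GRing.unit))
    (Theta_overrings : forall T, Theta T -> overring T)
    (Theta_locally_finite : locally_finite Theta)
    (D_bigcap : [set` domain_subring D] = \bigcap_(T in Theta) [set` T])
    (Inv_free : forall T, Theta T -> free_abelian (InvIdeal T)) :
  free_abelian (InvIdeal (domain_subring D)).
Proof.
pose phi (T : {T | Theta T}) := Inv_ext_map (Theta_overrings _ (svalP T)).
apply: (@free_abelian_family _ {T | Theta T} (fun T => InvIdeal (sval T)) phi).
- by move=> T; exact: Inv_ext_mapM.
- move=> I phiI.
  have sub J : (forall T, phi T J = 1%g) -> inv_ideal J `<=` [set` domain_subring D].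
    move=> phiJ x Jx; rewrite D_bigcap => T TT.
    exact: Inv_ext_map1_sub (phiJ (exist _ T TT)) _ Jx.
  (* Both [I] and its inverse extend trivially to every [T], so both lie in the intersection [D]. *)
  apply: inv_ideal_eq1; apply: sub => // T.
  apply: (mulgI (phi T I)); rewrite -[LHS]Inv_ext_mapM mulgV phiI mulg1.
  exact/Inv_ext/ideal_ext1/Theta_overrings/svalP.
- move=> I; have := ext_finite I Theta_overrings Theta_locally_finite.
  (* Finiteness is known for sets of subrings; it is pulled back to the index type along [sval],
     injective by proof irrelevance. *)
  move/(@finite_preimage {T | Theta T} _ _ sval) => fin.
  apply: sub_finite_set (fin _) => [T phiT|T U _ _]; last exact: eq_sig_hprop.
  split; first exact: svalP.
  by move=> IT; apply: phiT; exact: Inv_ext.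
- by move=> T; exact/Inv_free/svalP.
Qed.
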